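(* Let $R$ be a reduced commutative ring with identity which is a BFR and whose set $\mathrm{Min}(R)$ of minimal prime ideals is finite. Let $M$ be a unital $R$-module which is a BFM. Then the idealization $R(+)M$ is a BFR.
   Context: All rings are commutative with identity and all modules are unital. The idealization $R(+)M$ of an $R$-module $M$ is the ring with underlying set $R\times M$, componentwise addition, and multiplication $(r_1,x_1)(r_2,x_2)=(r_1r_2,\ r_1x_2+r_2x_1)$. A ring $A$ is a bounded factorization ring (BFR) if for every nonzero nonunit $r\in A$ there exists $n_r\in\mathbb{N}$ such that whenever $r=r_1\cdots r_n$ with all $r_i\in A$ nonunits, then $n\le n_r$. An $R$-module $M$ is a BFM if for every nonzero $x\in M$ there exists $n_x\in\mathbb{N}$ such that whenever $x=r_1\cdots r_n y$ with all $r_i\in R$ nonunits and $y\in M$, then $n\le n_x$. *)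

(* Defs.v *)
From HB Require Import structures.
From mathcomp Require Import all_boot all_algebra.
From mathcomp Require Import boolp classical_sets functions cardinality.

Set Implicit Arguments.
Unset Strict Implicit.
Unset Printing Implicit Defensive.

Import GRing.Theory.
Local Open Scope classical_set_scope.
Local Open Scope ring_scope.

(* [comPzRingType] is used throughout, rather than [comNzRingType], so that
   the zero ring is allowed.  [GRing.unit] and the ideals of ring_quotient.v
   exist only for nonzero rings, whence the definitions below. *)

Definition nonunit (A : comPzRingType) (a : A) : Prop :=
  ~ exists b : A, a * b = 1.

Definition reduced (A : comPzRingType) : Prop :=
  forall (a : A) (n : nat), a ^+ n = 0 -> a = 0.

Definition ideal (A : comPzRingType) (I : set A) : Prop :=
  [/\ I 0,
      forall a b, I a -> I b -> I (a + b)
    & forall a b, I b -> I (a * b)].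

Definition prime_ideal (A : comPzRingType) (P : set A) : Prop :=
  [/\ ideal P, ~ P 1 & forall a b, P (a * b) -> P a \/ P b].

Lemma prime_idealE (A : comNzRingType) (P : {pred A}) :
  prime_ideal [set a | a \in P] <->
  idealr_closed P /\ prime_idealr_closed P.
Proof.
split=> [[[P0 PD PM] P1 Pp]|[[P0 P1 PZ] Pp]].
  split; last by move=> a b /Pp [] ->; rewrite ?orbT.
  by split=> //; [apply/negP | move=> a u v Pu Pv; exact: PD (PM _ _ Pu) Pv].
split; [split=> //| exact/negP | by move=> a b /Pp /orP].
- by move=> a b Pa Pb; have := PZ 1 a b Pa Pb; rewrite mul1r.
- by move=> a b Pb; have := PZ a b 0 Pb P0; rewrite addr0.
Qed.

Definition minimal_primes (A : comPzRingType) : set (set A) :=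
  [set P | prime_ideal P /\
           forall Q : set A, prime_ideal Q -> Q `<=` P -> Q = P].

Arguments minimal_primes A : clear implicits.

Definition BFR (A : comPzRingType) : Prop :=
  forall r : A, r != 0 -> nonunit r ->
  exists N : nat, forall s : seq A,
    (forall a, a \in s -> nonunit a) ->
    r = \prod_(a <- s) a -> (size s <= N)%N.

Definition BFM (R : comPzRingType) (M : lmodType R) : Prop :=
  forall x : M, x != 0 ->
  exists N : nat, forall (s : seq R) (y : M),
    (forall a, a \in s -> nonunit a) ->
    x = (\prod_(a <- s) a) *: y -> (size s <= N)%N.

Arguments BFM R M : clear implicits.

(* An alias of the product, which keeps its additive structure but hides the
   componentwise multiplication that [R * M] has when [M] is itself a ring. *)
Definition idealization (R : comPzRingType) (M : lmodType R) : Type :=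
  (R * M)%type.
Arguments idealization R M : clear implicits.

Section IdealizationRing.
Variables (R : comPzRingType) (M : lmodType R).
Local Notation RM := (idealization R M).

HB.instance Definition _ := GRing.Zmodule.copy RM (R * M)%type.

Definition idealization_one : RM := (1, 0).

Definition idealization_mul (u v : RM) : RM :=
  (u.1 * v.1, u.1 *: v.2 + v.1 *: u.2).

Fact idealization_mulA : associative idealization_mul.
Proof.
move=> [a x] [b y] [c z]; congr pair => /=; first exact: mulrA.
by rewrite !scalerDr !scalerA addrA [c * a]mulrC [c * b]mulrC.
Qed.

Fact idealization_mulC : commutative idealization_mul.
Proof. by move=> [a x] [b y]; congr pair; rewrite /= (mulrC, addrC). Qed.

Fact idealization_mul1 : left_id idealization_one idealization_mul.
Proof.
by case=> a x; congr pair; rewrite /= ?mul1r // scale1r scaler0 addr0.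
Qed.

Fact idealization_mulDl : left_distributive idealization_mul +%R.
Proof.
move=> [a x] [b y] [c z]; congr pair => /=; first exact: mulrDl.
by rewrite scalerDl scalerDr addrACA.
Qed.

HB.instance Definition _ := GRing.Zmodule_isComPzRing.Build RM
  idealization_mulA idealization_mulC idealization_mul1 idealization_mulDl.

End IdealizationRing.

(* Main.v *)
Require Import Defs.
From mathcomp Require Import all_boot all_algebra.
From mathcomp Require Import boolp classical_sets functions cardinality.

(* Factors of an element of R(+)M project to factors in R, so only elements
   (0, x) with x nonzero need care.  Suppose such an element is a product.  Each
   minimal prime of R contains the R-component of some factor; picking one such
   factor per minimal prime gives at most #|Min(R)| factors whose product has its
   R-component in every minimal prime, hence is (0, y), as R is reduced.  If
   (b, z) is the product of the remaining factors, then x = b y, and the BFM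
   property bounds their number. *)

Set Implicit Arguments.
Unset Strict Implicit.
Unset Printing Implicit Defensive.

Import GRing.Theory.
Local Open Scope classical_set_scope.
Local Open Scope ring_scope.

Lemma prime_ideal_prod (A : comPzRingType) (P : set A) (T : eqType)
    (f : T -> A) (s : seq T) :
  prime_ideal P -> P (\prod_(t <- s) f t) -> exists2 t, t \in s & P (f t).
Proof.
case=> _ P1 Pp; elim: s => [|t s IHs]; first by rewrite big_nil.
rewrite big_cons => /Pp[Pt|/IHs[u us Pu]].
  by exists t; rewrite ?mem_head.
by exists u; rewrite ?inE ?us ?orbT.
Qed.

Section MaximalMultiplicativeSet.
Variables (A : comPzRingType) (a : A).
Hypotheses (A_reduced : reduced A) (a_neq0 : a != 0).

(* The empty set is allowed because it is the union of the empty chain in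
   Zorn's lemma. *)
Let multiplicative (S : set A) : Prop :=
  [/\ forall b c, S b -> S c -> S (b * c), ~ S 0
    & forall b, S b -> S 1 /\ S a].

Let multiplicative_powers : multiplicative (range (fun n => a ^+ n)).
Proof.
split.
- by move=> _ _ [m _ <-] [n _ <-]; exists (m + n)%N; rewrite ?exprD.
- by case=> n _ /A_reduced/eqP; rewrite (negPf a_neq0).
- by move=> _ _; split; [exists 0%N; rewrite ?expr0 | exists 1%N; rewrite ?expr1].
Qed.

(** Zorn's lemma gives a maximal [S]. If no element of [S] kills [b], reducedness allows the powers
    of [b] to be adjoined without reaching 0, so [b] is in [S] already. *)
Lemma exists_maximal_multiplicative : exists S : set A,
  [/\ S 1, S a, ~ S 0, forall b c, S b -> S c -> S (b * c)
    & forall b, ~ S b -> exists2 t, S t & t * b = 0].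
Proof.
have [F Fm Ftot|S [[SM S0 Sa] Smax]] := @Zorn_bigcup A multiplicative.
  split.
  - move=> b c [X FX Xb] [Y FY Yc]; have [XY|YX] := Ftot _ _ FX FY.
      by exists Y => //; have [YM _ _] := Fm _ FY; apply: YM (XY _ Xb) Yc.
    by exists X => //; have [XM _ _] := Fm _ FX; apply: XM Xb (YX _ Yc).
  - by case=> X FX X0; have [_ + _] := Fm _ FX; apply.
  - move=> b [X FX Xb]; have [_ _ /(_ _ Xb)[X1 Xa]] := Fm _ FX.
    by split; exists X.
(* The maximal set is not empty, since the powers of [a] would properly contain it. *)
have [S1 Sa'] : S 1 /\ S a.
  have [[b /Sa //]|Sempty] := pselect (exists b, S b).
  have [] := Smax _ _ multiplicative_powers; split=> [|powS].
    by move=> b Sb; case: Sempty; exists b.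
  by case: Sempty; exists (a ^+ 0); apply: powS; exists 0%N.
exists S; split=> // b Sb; apply: contrapT => no_ann.
pose S' := [set c | exists t, S t /\ exists n, c = t * b ^+ n].
have SS' : S `<=` S' by move=> t St; exists t; split=> //; exists 0%N; rewrite expr0 mulr1.
have [] := Smax S'.
  split=> // S'S; apply: Sb; apply: S'S.
  by exists 1; split=> //; exists 1%N; rewrite mul1r expr1.
split; last by move=> c _; split; apply: SS'.
  move=> _ _ [t [St [m ->]]] [u [Su [n ->]]].
  by exists (t * u); split; [exact: SM | exists (m + n)%N; rewrite exprD mulrACA].
(* From [t * b ^+ n = 0] it follows that [(t * b) ^+ n.+1 = 0]. *)
case=> t [St [n tbn0]]; apply: no_ann; exists t => //.
apply: (A_reduced (n := n.+1)).
by rewrite exprMn exprS exprSr mulrACA -tbn0 mul0r.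
Qed.

End MaximalMultiplicativeSet.

(** The complement of a maximal multiplicative set [S] containing [a] works: it consists of the
    elements killed by some element of [S], which makes it an ideal. *)
Lemma exists_minimal_prime_notin (A : comPzRingType) (a : A) :
  reduced A -> a != 0 -> exists2 P, minimal_primes A P & ~ P a.
Proof.
move=> A_reduced a_neq0.
have [S [S1 Sa S0 SM Sann]] := exists_maximal_multiplicative A_reduced a_neq0.
have annS t b : S t -> t * b = 0 -> ~ S b.
  by move=> St tb0 Sb; apply: S0; rewrite -tb0; apply: SM.
exists (~` S); last exact.
split.
  split; first split=> //.
  - move=> b c /Sann[t St tb0] /Sann[u Su uc0].
    apply: (annS (t * u)); first exact: SM.
    by rewrite mulrDr mulrAC tb0 mul0r -mulrA uc0 mulr0 addr0.
  - move=> b c /Sann[t St tc0]; apply: (annS t) => //.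
    by rewrite mulrCA tc0 mulr0.
  - by apply.
  - move=> b c nSbc; have [Sb|] := pselect (S b); last by left.
    by right=> Sc; apply: nSbc; apply: SM.
(* Minimality: [t * b = 0] lies in [Q] while [t], being in [S], does not, so [b] does. *)
move=> Q [[Q0 _ _] _ Qp] QS; apply/seteqP; split=> // b /Sann[t St tb0].
have [/QS //|//] : Q t \/ Q b by apply: Qp; rewrite tb0.
Qed.

(** By induction on [L], each new prime moves at most one factor from [s2] to [s1], and none if it
    already contains the product over [s1]. *)
Lemma short_subproduct (A : comPzRingType) (T : eqType) (f : T -> A)
    (s : seq T) (L : seq (set A)) :
    (forall P, P \in L -> prime_ideal P) ->
    (forall P, P \in L -> P (\prod_(t <- s) f t)) ->
  exists s1 s2, [/\ perm_eq s (s1 ++ s2), (size s1 <= size L)%N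
    & forall P, P \in L -> P (\prod_(t <- s1) f t)].
Proof.
elim: L => [|P L IHL] Lp Ls; first by exists [::], s.
have [|Q LQ|s1 [s2 [s12 s1L Ls1]]] := IHL.
- by move=> Q LQ; apply: Lp; rewrite inE LQ orbT.
- by apply: Ls; rewrite inE LQ orbT.
have Pp := Lp P (mem_head _ _); have [[_ _ PM] _ Pp2] := Pp.
have := Ls P (mem_head _ _).
rewrite (perm_big _ s12) big_cat /= => /Pp2[Ps1|].
  exists s1, s2; split=> //; first exact: leqW.
  by move=> Q; rewrite inE => /predU1P[->//|/Ls1].
move=> /(prime_ideal_prod Pp)[t ts2 Pt].
exists (t :: s1), (rem t s2); split=> //.
  rewrite (perm_trans s12) // perm_sym -cat1s -catA perm_catCA perm_cat2l.
  by rewrite perm_sym; exact: perm_to_rem.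
move=> Q; rewrite big_cons inE => /predU1P[->|LQ].
  by rewrite mulrC; exact: PM Pt.
have [[_ _ QM] _ _] : prime_ideal Q by apply: Lp; rewrite inE LQ orbT.
exact: QM (Ls1 _ LQ).
Qed.

Section Idealization.
Variables (R : comPzRingType) (M : lmodType R).
Local Notation RM := (idealization R M).

Lemma idealization_nonunit_fst (u : RM) : nonunit u -> nonunit u.1.
Proof.
(* If [a * b = 1], the inverse of [(a, x)] is [(b, - b ^+ 2 *: x)]. *)
case: u => a x nu [b /= ab1]; apply: nu; exists (b, - (b * b) *: x).
by congr pair; rewrite /= ?ab1 // scalerA mulrN mulrA ab1 mul1r scaleNr addNr.
Qed.

Lemma idealization_prod_fst (s : seq RM) :
  (\prod_(u <- s) u).1 = \prod_(u <- s) u.1.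
Proof. by elim/big_rec2: _ => // u a b _ <-. Qed.

End Idealization.

Theorem corollary7 (R : comPzRingType) (M : lmodType R)
  (R_reduced : reduced R) (R_BFR : BFR R)
  (MinR_finite : finite_set (minimal_primes R))
  (M_BFM : BFM R M) :
  BFR (idealization R M).
Proof.
case=> r x rx_neq0 rx_nonunit.
have nonunit_map (s : seq (idealization R M)) :
    (forall u, u \in s -> nonunit u) ->
    forall a, a \in [seq u.1 | u <- s] -> nonunit a.
  by move=> s_nonunit _ /mapP[u us ->]; apply/idealization_nonunit_fst/s_nonunit.
have [r0|r_neq0] := eqVneq r 0; last first.
  have [N RN] := R_BFR r r_neq0 (idealization_nonunit_fst rx_nonunit).
  exists N => s s_nonunit rxE; rewrite -(size_map fst).
  apply: RN; first exact: nonunit_map.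
  by rewrite big_map -idealization_prod_fst -rxE.
have x_neq0 : x != 0 by apply: contraNneq rx_neq0 => ->; rewrite r0.
have [N MN] := M_BFM x x_neq0.
have [L minE] := (finite_seqP _).1 MinR_finite.
have minL P : P \in L <-> minimal_primes R P by rewrite minE.
exists (size L + N)%N => s s_nonunit rxE.
have Lprime P : P \in L -> prime_ideal P by move=> /minL[].
have s0 : \prod_(u <- s) u.1 = 0 by rewrite -idealization_prod_fst -rxE.
have [P LP|s1 [s2 [s12 s1L Ls1]]] :=
  @short_subproduct _ _ (fun u : idealization R M => u.1) s L Lprime.
  by rewrite s0; have [[]] := Lprime P LP.
have s1_0 : \prod_(u <- s1) u.1 = 0.
  apply: contrapT => /eqP /(exists_minimal_prime_notin R_reduced)[P minP].
  by apply; apply: Ls1; apply/minL.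
rewrite (perm_size s12) size_cat leq_add // -(size_map fst s2).
apply: (MN _ (\prod_(u <- s1) u).2).
  apply: nonunit_map => u us2; apply: s_nonunit.
  by rewrite (perm_mem s12) mem_cat us2 orbT.
(* In the second component of the product, the term scaled by the first component over [s1]
   vanishes. *)
have := congr1 snd rxE; rewrite (perm_big _ s12) big_cat /= => ->.
by rewrite !idealization_prod_fst s1_0 scale0r add0r big_map.
Qed.
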